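(* Let $X$ be a set and let $\{\alpha_i : 1 \leq i \leq N\}$ be a finite set of atoms of $\mathbb{3}^{X}$. For each atom $\alpha$, let $x_\alpha$ denote the unique element of $X$ with $\alpha(x_\alpha) \in \{T,U\}$. Then $\bigoplus_{i=1}^{N} \alpha_i$ exists if and only if $x_{\alpha_i} \neq x_{\alpha_j}$ for all $i \neq j$. Further, in that case $$\Big(\bigoplus_{i=1}^{N}\alpha_i\Big)(x) = \begin{cases} \alpha_i(x_{\alpha_i}), & \text{if } x = x_{\alpha_i};\\ F, & \text{otherwise.}\end{cases}$$
   Context: $\mathbb{3}$ denotes McCarthy's three-valued $C$-algebra on $\{T,F,U\}$ with operations: $\neg T = F$, $\neg F = T$, $\neg U = U$; $T\wedge x = x$, $F \wedge x = F$, $U \wedge x = U$; $T \vee x = T$, $F \vee x = x$, $U \vee x = U$. $\mathbb{3}^{X}$ has pointwise operations and constant $\mathbf{F}$. Order: $a \leq b$ iff $a \vee b = b$. An atom is $a \neq \mathbf{F}$ such that any $b$ with $\mathbf{F}\leq b \leq a$, $b \neq a$ equals $\mathbf{F}$; every atom $\alpha$ of $\mathbb{3}^X$ has exactly one $x \in X$ with $\alpha(x) \in \{T,U\}$. For finitely many atoms $a_1,\dots,a_N$: if for every bijection $\sigma$ of $\{1,\dots,N\}$ we have $a_{\sigma(1)}\vee\cdots\vee a_{\sigma(N)} = a_1 \vee \cdots \vee a_N$ (the join being bracketed associatively), then $\bigoplus_{i=1}^N a_i$ is said to exist and is defined to be this common value. *)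

(* Defs.v *)
From HB Require Import structures.
From mathcomp Require Import all_boot perm.
From mathcomp Require Import boolp.

Set Implicit Arguments.
Unset Strict Implicit.
Unset Printing Implicit Defensive.

Inductive three := T3 | F3 | U3.

                                                              
Definition or3 (a b : three) : three :=
  match a with T3 => T3 | F3 => b | U3 => U3 end.

Definition three_pow (X : Type) : Type := X -> three.

Definition powF (X : Type) : three_pow X := fun=> F3.
Arguments powF {X}.

Definition pow_or (X : Type) (a b : three_pow X) : three_pow X :=
  fun x => or3 (a x) (b x).

Definition pow_le (X : Type) (a b : three_pow X) : Prop := pow_or a b = b.

Definition is_atom (X : Type) (a : three_pow X) : Prop :=
  a <> powF /\
  forall b : three_pow X, pow_le powF b -> pow_le b a -> b <> a -> b = powF.

Lemma or3A : associative or3. Proof. by case. Qed.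
Lemma or3F : right_id F3 or3. Proof. by case. Qed.

Lemma pow_orA (X : Type) : associative (@pow_or X).
Proof. by move=> a b c; apply: funext => x; rewrite /pow_or or3A. Qed.

Lemma pow_For (X : Type) : left_id powF (@pow_or X).
Proof. by []. Qed.

Lemma pow_orF (X : Type) : right_id powF (@pow_or X).
Proof. by move=> a; apply: funext => x; rewrite /pow_or or3F. Qed.

                                                                          
                                                            
HB.instance Definition _ (X : Type) :=
  Monoid.isLaw.Build (three_pow X) powF (@pow_or X)
    (@pow_orA X) (@pow_For X) (@pow_orF X).

Lemma atom_support (X : Type) (a : three_pow X) :
  is_atom a -> exists! x, a x = T3 \/ a x = U3.
Proof.
move=> [aN0 amin].
have TU (t : three) : t <> F3 -> t = T3 \/ t = U3 by case: t; auto.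
have [x ax] : exists x, a x <> F3.
  by apply: contra_notP aN0 => /forallNP aF; apply: funext => x; apply: contrapT.
exists x; split=> [|y ay]; first exact: TU.
pose b : three_pow X := fun z => if `[< z = x >] then a z else F3.
have bx : b x = a x by rewrite /b asboolT.
have ba : b = a.
  apply: contrapT => bNa; apply: ax; rewrite -bx (amin b) //.
  by apply: funext => z; rewrite /pow_or /b; case: asboolP => // _; case: (a z).
apply: contrapT => xy; have : b y = F3 by rewrite /b asboolF // => /esym.
by rewrite ba; case: ay => ->.
Qed.

                                                                
Definition atom_pt (X : Type) (a : three_pow X) (ha : is_atom a) : X :=
  sval (cid (atom_support ha)).

Lemma atom_ptP (X : Type) (a : three_pow X) (ha : is_atom a) :
  unique (fun x => a x = T3 \/ a x = U3) (atom_pt ha).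
Proof. exact: svalP (cid (atom_support ha)). Qed.

Definition join_seq (X : Type) (N : nat) (a : 'I_N -> three_pow X) :
  three_pow X := \big[@pow_or X/powF]_(i < N) a i.

Definition oplus_exists (X : Type) (N : nat) (a : 'I_N -> three_pow X) : Prop :=
  forall s : 'S_N, join_seq (fun i => a (s i)) = join_seq a.

                                                                
Definition oplus (X : Type) (N : nat) (a : 'I_N -> three_pow X)
  (_ : oplus_exists a) : three_pow X := join_seq a.

(* Main.v *)
(* At a point x, the join of a sequence is the first value different from F.
   If two distinct atoms live on the same point, their values there differ, and
   moving one or the other to the front of the sequence changes the join; if the
   points are distinct, at most one atom is non-F at x, so the order is
   irrelevant and the join is that value. *)

Require Import Defs.
From HB Require Import structures.
From mathcomp Require Import all_boot perm.
From mathcomp Require Import boolp.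

Set Implicit Arguments.
Unset Strict Implicit.
Unset Printing Implicit Defensive.

Lemma join_seqE (X : Type) (N : nat) (a : 'I_N -> three_pow X) (x : X) :
  join_seq a x = \big[Defs.or3/F3]_(i < N) a i x.
Proof. exact: (big_morph (fun b : three_pow X => b x)). Qed.

Lemma join_seq_head (X : Type) (n : nat) (a : 'I_n.+1 -> three_pow X) (x : X) :
  a ord0 x <> F3 -> join_seq a x = a ord0 x.
Proof. by rewrite join_seqE big_ord_recl; case: (a ord0 x). Qed.

(** The set of [F3] and [c] is closed under [or3]; in it [F3] is neutral and [c] absorbs from either
    side, so the position of [j] in [r] does not matter. *)
Lemma big_or3_const (I : eqType) (r : seq I) (f : I -> three) (c : three) (j : I) :
    (forall i, f i = F3 \/ f i = c) -> j \in r -> f j = c ->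
  \big[Defs.or3/F3]_(i <- r) f i = c.
Proof.
move=> fFc + fj; elim: r => // k r IHr; rewrite inE big_cons.
case/predU1P => [<-|/IHr ->]; last by case: (fFc k) => -> //; case: c {fFc fj IHr}.
have : \big[Defs.or3/F3]_(i <- r) f i = F3 \/ \big[Defs.or3/F3]_(i <- r) f i = c.
  apply: (big_ind (fun t => t = F3 \/ t = c)) => [|t u|i _]; [by left| |exact: fFc].
  by case=> -> [] ->; case: (c); auto.
by rewrite fj; case=> ->; case: (c).
Qed.

Lemma atom_pt_neqF (X : Type) (a : three_pow X) (ha : is_atom a) :
  a (atom_pt ha) <> F3.
Proof. by have [[->|->] _] := atom_ptP ha. Qed.

Lemma atom_offF (X : Type) (a : three_pow X) (ha : is_atom a) (x : X) :
  x <> atom_pt ha -> a x = F3.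
Proof.
have [_ uniq_pt] := atom_ptP ha => xN.
by case ax: (a x) => //; case: xN; apply/esym/uniq_pt; auto.
Qed.

(** Off their common point both atoms are [F3]. Hence distinct atoms on one point must differ in
    value there. *)
Lemma atom_eq (X : Type) (a b : three_pow X) (ha : is_atom a) (hb : is_atom b) :
  atom_pt ha = atom_pt hb -> a (atom_pt ha) = b (atom_pt ha) -> a = b.
Proof.
move=> pt_eq ab; apply: funext => x.
have [->//|xN] := EM (x = atom_pt ha).
by rewrite (atom_offF xN) (@atom_offF _ _ hb) // -pt_eq.
Qed.

Section Atoms.

Variables (X : Type) (N : nat) (alpha : 'I_N -> three_pow X).
Hypothesis alpha_atom : forall i, is_atom (alpha i).

Let pt i := atom_pt (alpha_atom i).

Lemma join_seq_perm_off (s : 'S_N) (x : X) :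
  (forall i, x <> pt i) -> join_seq (fun i => alpha (s i)) x = F3.
Proof.
move=> xN; rewrite join_seqE.
apply: (big_ind (fun t => t = F3)) => // [t u -> ->|i _] //.
exact: atom_offF (xN (s i)).
Qed.

Lemma join_seq_perm_pt (s : 'S_N) (i : 'I_N) :
    (forall j k, j <> k -> pt j <> pt k) ->
  join_seq (fun j => alpha (s j)) (pt i) = alpha i (pt i).
Proof.
move=> pt_neq; rewrite join_seqE.
(* In the permuted sequence [alpha i] sits at position [s^-1 i]; all other terms are [F3] at
   [pt i]. *)
apply: (@big_or3_const _ _ _ _ (s^-1 i)%g); rewrite ?mem_index_enum ?permKV // => j.
have [->|/eqP sjNi] := eqVneq (s j) i; first by right.
by left; apply: (@atom_offF _ _ (alpha_atom (s j))); apply: pt_neq => /esym.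
Qed.

Lemma oplus_exists_pt_neq : injective alpha -> oplus_exists alpha ->
  forall i j, i <> j -> pt i <> pt j.
Proof.
(* Splitting [N] makes [ord0] available; for [N = 0] there is no index [i]. *)
case: N alpha alpha_atom @pt => [|n] a ha p a_inj ex i j ij pij; first by case: i {ij pij}.
have join_pt k : join_seq a (p k) = a k (p k).
  (* The transposition puts [a k] first, and its value at [p k], not being [F3], decides the join
     there. *)
  by rewrite -(ex (tperm ord0 k)) join_seq_head tpermL //; apply: atom_pt_neqF.
(* At a shared point both values equal that of the join, so the two atoms coincide, against
   injectivity. *)
by apply/ij/a_inj/(atom_eq pij); rewrite -/(p i) -join_pt pij join_pt.
Qed.

Lemma pt_neq_oplus_exists : (forall i j, i <> j -> pt i <> pt j) ->
  oplus_exists alpha.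
Proof.
move=> pt_neq s; apply: funext => x.
(* With the identity permutation inserted, both sides are permuted joins, whose pointwise values do
   not depend on the permutation. *)
have -> : join_seq alpha = join_seq (fun i => alpha ((1 : 'S_N)%g i)).
  by congr join_seq; apply: funext => i; rewrite perm1.
have [[i ->]|/forallNP xN] := EM (exists i, x = pt i).
  by rewrite !join_seq_perm_pt.
by rewrite !join_seq_perm_off.
Qed.

End Atoms.

Theorem theorem2p33 (X : Type) (N : nat) (alpha : 'I_N -> three_pow X)
    (alpha_atom : forall i : 'I_N, is_atom (alpha i))
    (alpha_inj : injective alpha) :
  (oplus_exists alpha <->
     forall i j : 'I_N, i <> j ->
       atom_pt (alpha_atom i) <> atom_pt (alpha_atom j)) /\
  (forall ex : oplus_exists alpha,
     (forall i : 'I_N,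
        oplus ex (atom_pt (alpha_atom i)) =
        alpha i (atom_pt (alpha_atom i))) /\
     (forall x : X,
        (forall i : 'I_N, x <> atom_pt (alpha_atom i)) -> oplus ex x = F3)).
Proof.
split=> [|ex].
  by split; [apply: oplus_exists_pt_neq | apply: pt_neq_oplus_exists].
have pt_neq := @oplus_exists_pt_neq _ _ _ alpha_atom alpha_inj ex.
(* Existence at the identity puts the sum in the permuted form whose values are known. *)
rewrite /oplus -(ex 1%g); split=> [i|x xN].
  exact: join_seq_perm_pt.
exact: join_seq_perm_off xN.
Qed.
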